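(* Let $\Gamma$ be a group, let $B$ be a subset of $\Gamma$, and let $H_L, H_R$ be subgroups of $\Gamma$. If $\Gamma = H_L B H_R$ is a bi-gyrodecomposition, then $B$ equipped with the bi-transversal operation $\odot$ forms a bi-gyrogroupoid, where the left and right automorphisms associated with $a,b\in B$ are the left gyration $\mathrm{lgyr}[a,b]$ and the right gyration $\mathrm{rgyr}[a,b]$ of $B$.
   Context: A groupoid $(B,\oplus_b)$ is a non-empty set $B$ with a binary operation; $\mathrm{Aut}(B,\oplus_b)$ is the group of bijections of $B$ preserving the operation. Bi-gyrogroupoid: a groupoid $(B,\oplus_b)$ such that (BG1) there is $0\in B$ with $0\oplus_b a = a\oplus_b 0 = a$ for all $a\in B$; (BG2) for each $a\in B$ there is $b\in B$ with $b\oplus_b a = 0$; (BG3) each pair $a,b\in B$ corresponds to a left automorphism $\mathrm{lgyr}[a,b]$ and a right automorphism $\mathrm{rgyr}[a,b]$ in $\mathrm{Aut}(B,\oplus_b)$ such that for all $c\in B$, $(a\oplus_b b)\oplus_b \mathrm{lgyr}[a,b]c = \mathrm{rgyr}[b,c]a\oplus_b(b\oplus_b c)$; (BG4) for all $a,b\in B$, $\mathrm{rgyr}[a,b]=\mathrm{rgyr}[\mathrm{lgyr}[a,b]a,\,a\oplus_b b]$ and $\mathrm{lgyr}[a,b]=\mathrm{lgyr}[\mathrm{lgyr}[a,b]a,\,a\oplus_b b]$; (BG5) for all $a\in B$, $\mathrm{lgyr}[a,0]$ and $\mathrm{rgyr}[a,0]$ are the identity map of $B$. Bi-transversal: a subset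 $B$ of a group $\Gamma$ is a bi-transversal of subgroups $H_L,H_R$ if every $g\in\Gamma$ can be written uniquely as $g=h_\ell b h_r$ with $h_\ell\in H_L$, $b\in B$, $h_r\in H_R$. Then for $b_1,b_2\in B$ there are unique $h_\ell(b_1,b_2)\in H_L$, $b_1\odot b_2\in B$, $h_r(b_1,b_2)\in H_R$ with $b_1b_2 = h_\ell(b_1,b_2)(b_1\odot b_2)h_r(b_1,b_2)$; $\odot$ is the bi-transversal operation and $h_\ell,h_r$ are the left and right transversal maps. The left and right gyrations are $\mathrm{lgyr}[b_1,b_2]b = h_r(b_1,b_2)\,b\,h_r(b_1,b_2)^{-1}$ and $\mathrm{rgyr}[b_1,b_2]b = h_\ell(b_1,b_2)^{-1}\,b\,h_\ell(b_1,b_2)$ for $b\in B$. Bi-gyrotransversal: a bi-transversal $B$ of $H_L,H_R$ such that $hBh^{-1}\subseteq B$ for all $h\in H_L$ and all $h\in H_R$, and $h_\ell h_r=h_rh_\ell$ for all $h_\ell\in H_L,h_r\in H_R$. Twisted subgroup: a subset $B$ of $\Gamma$ with $1\in B$; $b\in B\Rightarrow b^{-1}\in B$; and $a,b\in B\Rightarrow aba\in B$. Bi-gyrodecomposition: a decomposition $\Gamma=H_LBH_R$ such that $B$ is a bi-gyrotransversal of $H_L$ and $H_R$ in $\Gamma$, $B$ is a twisted subgroup of $\Gamma$, and $h_\ell(a,b)^{-1}=h_\ell(b,a)$, $h_r(a,b)^{-1}=h_r(b,a)$ for all $a,b\in B$. *)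

(* Defs.v *)
From mathcomp Require Import all_boot.
From mathcomp Require Import boolp classical_sets.

Set Implicit Arguments.
Unset Strict Implicit.
Unset Printing Implicit Defensive.

Local Open Scope group_scope.

Definition automorphism (T : Type) (op : T -> T -> T) (f : T -> T) : Prop :=
  bijective f /\ {morph f : x y / op x y}.

(* The axioms (BG1)-(BG5) for a given identity element and given families
   of left and right automorphisms. *)
Record bigyrogroupoid_axioms (T : Type) (op : T -> T -> T) (zero : T)
    (lgyr rgyr : T -> T -> T -> T) : Prop := BigyrogroupoidAxioms {
  bg1 : forall a, op zero a = a /\ op a zero = a;
  bg2 : forall a, exists b, op b a = zero;
  bg3_lgyr_aut : forall a b, automorphism op (lgyr a b);
  bg3_rgyr_aut : forall a b, automorphism op (rgyr a b);
  bg3 : forall a b c,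
    op (op a b) (lgyr a b c) = op (rgyr b c a) (op b c);
  bg4_rgyr : forall a b, rgyr a b =1 rgyr (lgyr a b a) (op a b);
  bg4_lgyr : forall a b, lgyr a b =1 lgyr (lgyr a b a) (op a b);
  bg5_lgyr : forall a, lgyr a zero =1 id;
  bg5_rgyr : forall a, rgyr a zero =1 id
}.

Definition bigyrogroupoid (T : Type) (op : T -> T -> T)
    (lgyr rgyr : T -> T -> T -> T) : Prop :=
  exists zero : T, bigyrogroupoid_axioms op zero lgyr rgyr.

Record subgroup (G : groupType) := Subgroup {
  subgroup_set :> set G;
  subgroupP : group_closed (mem subgroup_set)
}.

Lemma subgroupV (G : groupType) (H : subgroup G) (h : G) :
  h \in (H : set G) -> h^-1 \in (H : set G).
Proof. exact: (group_closedV (subgroupP H)). Qed.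

Definition twisted_subgroup (G : groupType) (B : set G) : Prop :=
  [/\ 1 \in B,
      {in B, forall b, b^-1 \in B}
    & {in B &, forall a b, a * b * a \in B}].

Section Bitransversal.
Variables (G : groupType) (HL : subgroup G) (B : set G) (HR : subgroup G).

(* Uniqueness is uniqueness of the whole triple, which iterating [exists!]
   over the three components would not express. *)
Definition bitransversal : Prop :=
  forall g : G, exists! t : HL * B * HR,
    g = val t.1.1 * val t.1.2 * val t.2.

Record bigyrotransversal : Prop := Bigyrotransversal {
  bgt_bitransversal :> bitransversal;
  bgt_conjL : {in (HL : set G) & B, forall h b, h * b * h^-1 \in B};
  bgt_conjR : {in (HR : set G) & B, forall h b, h * b * h^-1 \in B};
  bgt_commute : {in (HL : set G) & (HR : set G), forall hl hr, hl * hr = hr * hl}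
}.

Section TransversalMaps.
Hypothesis BT : bitransversal.

Definition bifactors (g : G) : HL * B * HR := sval (cid (BT g)).

Lemma bifactorsE (g : G) :
  g = val (bifactors g).1.1 * val (bifactors g).1.2 * val (bifactors g).2.
Proof. by rewrite /bifactors; case: cid => t []. Qed.

Definition transL (a b : B) : HL := (bifactors (val a * val b)).1.1.
Definition bitrans_op (a b : B) : B := (bifactors (val a * val b)).1.2.
Definition transR (a b : B) : HR := (bifactors (val a * val b)).2.

End TransversalMaps.

Section Gyrations.
Hypothesis BG : bigyrotransversal.

Lemma lgyr_subproof (a b c : B) :
  val (transR BG a b) * val c * (val (transR BG a b))^-1 \in B.
Proof. exact: (bgt_conjR BG) (valP _) (valP _). Qed.

Lemma rgyr_subproof (a b c : B) :
  (val (transL BG a b))^-1 * val c * val (transL BG a b) \in B.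
Proof.
rewrite -[X in _ * X \in _]invgK.
exact: (bgt_conjL BG) (subgroupV (valP _)) (valP _).
Qed.

Definition lgyr (a b c : B) : B := exist (fun x => x \in B) _ (lgyr_subproof a b c).
Definition rgyr (a b c : B) : B := exist (fun x => x \in B) _ (rgyr_subproof a b c).

End Gyrations.

(* The equality Gamma = HL B HR is part of [bitransversal]. *)
Record bigyrodecomposition : Prop := Bigyrodecomposition {
  bgd_bigyrotransversal :> bigyrotransversal;
  bgd_twisted : twisted_subgroup B;
  bgd_transLV : forall a b : B,
    (val (transL bgd_bigyrotransversal a b))^-1
      = val (transL bgd_bigyrotransversal b a);
  bgd_transRV : forall a b : B,
    (val (transR bgd_bigyrotransversal a b))^-1
      = val (transR bgd_bigyrotransversal b a)
}.

End Bitransversal.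

(* Main.v *)
Require Import Defs.
From mathcomp Require Import all_boot.
From mathcomp Require Import boolp classical_sets.

(** Everything rests on the uniqueness of the factorization of an element as
    hl * b * hr.  Write ab = l (a o b) r with l = transL a b, r = transR a b.

    - Conjugation by an element of HL or HR maps each of HL, B and HR into
      itself, the other subgroup being fixed pointwise because HL and HR
      commute.  Hence it carries the factorization of ab to that of the
      conjugated product, and so preserves the operation
      ([conj_automorphism]).  Gyrations are such conjugations.
    - (BG3) is read off from two ways of factoring abc: moving r to the right
      past c gives l ((a o b) (lgyr[a,b] c)) r, while moving transL b c to the
      left past a gives transL b c ((rgyr[b,c] a) (b o c)) transR b c.  The
      B-components agree ([bitrans_op_gyro_assoc]).
    - (BG4) comes from the first of these with c = a.  As B is a twisted
      subgroup, aba is in B, hence its outer factors are trivial; with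
      x = lgyr[a,b] a and y = a o b this says that transL y x and transR y x
      are the inverses of l and r, and the inversion hypothesis on the
      transversal maps turns this into transL x y = l and transR x y = r
      ([trans_lgyr_op]).
    - (BG1), (BG2) and (BG5) hold because 1 is in B and B is closed under
      inverses: a * 1, 1 * a and a^-1 * a lie in B, hence are their own
      factorizations. *)

Set Implicit Arguments.
Unset Strict Implicit.
Unset Printing Implicit Defensive.

Local Open Scope group_scope.


Lemma subgroup1 (G : groupType) (H : subgroup G) : 1 \in (H : set G).
Proof. by case: (subgroupP H). Qed.

Lemma subgroupM (G : groupType) (H : subgroup G) :
  {in (H : set G) &, forall x y, x * y \in (H : set G)}.
Proof. exact: (group_closedM (subgroupP H)). Qed.

(** * Uniqueness of the factorization *)

Section Bitransversal.
Variables (G : groupType) (HL : subgroup G) (B : set G) (HR : subgroup G).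
Hypothesis BT : bitransversal HL B HR.

Lemma bifactorsK (h : HL) (b : B) (k : HR) :
  bifactors BT (val h * val b * val k) = (h, b, k).
Proof. by rewrite /bifactors; case: cid => t [_ /= t_uniq]; exact: t_uniq. Qed.

Lemma bitrans_factorE (a b : B) :
  val a * val b = val (transL BT a b) * val (bitrans_op BT a b)
                  * val (transR BT a b).
Proof. exact: bifactorsE. Qed.

(** Stated on elements of G, so that a factorization found by computing in G
    can be used without first packing its factors into the subtypes. *)
Lemma bifactors_val (g h x k : G) :
    h \in (HL : set G) -> x \in B -> k \in (HR : set G) -> g = h * x * k ->
  [/\ val (bifactors BT g).1.1 = h, val (bifactors BT g).1.2 = x
    & val (bifactors BT g).2 = k].
Proof.
move=> Hh Bx Hk ->.
by rewrite (bifactorsK (exist _ h Hh) (exist _ x Bx) (exist _ k Hk)).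
Qed.

Lemma bifactors_in (g : G) :
    g \in B ->
  [/\ val (bifactors BT g).1.1 = 1, val (bifactors BT g).1.2 = g
    & val (bifactors BT g).2 = 1].
Proof.
by move=> Bg; apply: bifactors_val; rewrite ?subgroup1 ?mul1g ?mulg1.
Qed.

Lemma bitrans_op_in (a b : B) :
  val a * val b \in B -> val (bitrans_op BT a b) = val a * val b.
Proof. by case/bifactors_in. Qed.

(** * Conjugation *)

Definition conj_stable (g : G) (A : set G) : Prop :=
  {in A, forall x, g * x * g^-1 \in A}.

(** Conjugating a * b = hl * x * hr by g gives a factorization of the
    conjugated product, whose middle factor must be the product in B of the
    conjugates. *)
Lemma conj_bitrans_op (g : G) (f : B -> B) :
    conj_stable g HL -> conj_stable g HR ->
    (forall b, val (f b) = g * val b * g^-1) ->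
  {morph f : a b / bitrans_op BT a b}.
Proof.
move=> gHL gHR fE a b; apply: val_inj.
have conjM x y : g * x * g^-1 * (g * y * g^-1) = g * (x * y) * g^-1.
  by rewrite !mulgA mulgVK.
have fab : val (f a) * val (f b) = g * val (transL BT a b) * g^-1
    * val (f (bitrans_op BT a b)) * (g * val (transR BT a b) * g^-1).
  by rewrite !fE !conjM bitrans_factorE.
have [_ -> _ //] := bifactors_val (gHL _ (valP _)) (valP _)
  (gHR _ (valP _)) fab.
Qed.

Lemma conj_automorphism (g : G) (f : B -> B) :
    conj_stable g HL -> conj_stable g HR -> conj_stable g^-1 B ->
    (forall b, val (f b) = g * val b * g^-1) ->
  automorphism (bitrans_op BT) f.
Proof.
move=> gHL gHR gVB fE; split; last exact: conj_bitrans_op fE.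
pose f' (b : B) : B := exist (fun x => x \in B) _ (gVB _ (valP b)).
exists f' => b; apply: val_inj => /=.
  by rewrite fE invgK !mulgA mulVg mul1g mulgVK.
by rewrite fE /= invgK !mulgA mulgV mul1g mulgK.
Qed.

Lemma conj_stable_subgroup (H : subgroup G) (g : G) :
  g \in (H : set G) -> conj_stable g H.
Proof. by move=> Hg x Hx; rewrite !subgroupM ?subgroupV. Qed.

Lemma conj_stable_commute (A : set G) (g : G) :
  {in A, forall x, g * x = x * g} -> conj_stable g A.
Proof. by move=> gA x Ax; rewrite gA // mulgK. Qed.

End Bitransversal.

(** * Gyrations *)

Section Bigyrotransversal.
Variables (G : groupType) (HL : subgroup G) (B : set G) (HR : subgroup G).
Hypothesis BG : bigyrotransversal HL B HR.

Lemma lgyr_automorphism (a b : B) :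
  automorphism (bitrans_op BG) (lgyr BG a b).
Proof.
have HRr := valP (transR BG a b).
apply: (@conj_automorphism _ _ _ _ _ (val (transR BG a b))) => //.
- by apply: conj_stable_commute => h Hh; rewrite -(bgt_commute BG).
- exact: conj_stable_subgroup.
- by move=> x Bx; apply: (bgt_conjR BG) => //; apply: subgroupV.
Qed.

Lemma rgyr_automorphism (a b : B) :
  automorphism (bitrans_op BG) (rgyr BG a b).
Proof.
have HLl := valP (transL BG a b); have HLlV := subgroupV HLl.
apply: (@conj_automorphism _ _ _ _ _ (val (transL BG a b))^-1).
- exact: conj_stable_subgroup.
- by apply: conj_stable_commute => k Hk; rewrite (bgt_commute BG).
- by rewrite invgK => x Bx; apply: (bgt_conjL BG).
- by move=> x; rewrite invgK.
Qed.

(** lgyr[a,b] is the conjugation that lets the right factor of ab pass to the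
    right of c. *)
Lemma mulg3_lgyr (a b c : B) (d := bitrans_op BG a b) (c' := lgyr BG a b c) :
  val a * val b * val c =
    (val (transL BG a b) * val (transL BG d c')) * val (bitrans_op BG d c')
    * (val (transR BG d c') * val (transR BG a b)).
Proof.
have dc' := bitrans_factorE BG d c'.
transitivity (val (transL BG a b) * (val d * val c') * val (transR BG a b)).
  by rewrite (bitrans_factorE BG a b) /= !mulgA mulgVK.
by rewrite dc' !mulgA.
Qed.

(** rgyr[b,c] is the conjugation that lets the left factor of bc pass to the
    left of a. *)
Lemma mulg3_rgyr (a b c : B) (d := bitrans_op BG b c) (a' := rgyr BG b c a) :
  val a * val b * val c =
    (val (transL BG b c) * val (transL BG a' d)) * val (bitrans_op BG a' d)
    * (val (transR BG a' d) * val (transR BG b c)).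
Proof.
have a'd := bitrans_factorE BG a' d.
transitivity (val (transL BG b c) * (val a' * val d) * val (transR BG b c)).
  by rewrite -mulgA (bitrans_factorE BG b c) /= !mulgA mulgV mul1g.
by rewrite a'd !mulgA.
Qed.

(** The identity (BG3): both sides are the B-component of abc. *)
Lemma bitrans_op_gyro_assoc (a b c : B) :
  bitrans_op BG (bitrans_op BG a b) (lgyr BG a b c)
    = bitrans_op BG (rgyr BG b c a) (bitrans_op BG b c).
Proof.
pose bi := bifactors_val BG; apply: val_inj.
have [_ <- _] := bi _ _ _ _ (subgroupM (valP _) (valP _)) (valP _)
  (subgroupM (valP _) (valP _)) (mulg3_lgyr a b c).
by have [_ <- _] := bi _ _ _ _ (subgroupM (valP _) (valP _)) (valP _)
  (subgroupM (valP _) (valP _)) (mulg3_rgyr a b c).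
Qed.

(** The inclusion of aba in B kills the outer factors of its factorization in
    [mulg3_lgyr]. *)
Lemma trans_op_lgyr (a b : B) (x := lgyr BG a b a) (y := bitrans_op BG a b) :
    val a * val b * val a \in B ->
  val (transL BG y x) = (val (transL BG a b))^-1 /\
  val (transR BG y x) = (val (transR BG a b))^-1.
Proof.
move=> Baba; have [lE _ rE] := bifactors_val BG
  (subgroupM (valP _) (valP _)) (valP _) (subgroupM (valP _) (valP _))
  (mulg3_lgyr a b a).
have [l1 _ r1] := bifactors_in BG Baba.
rewrite l1 in lE; rewrite r1 in rE; split.
  by rewrite (mulg1_eq (esym lE)).
by rewrite -(mulg1_eq (esym rE)) invgK.
Qed.

End Bigyrotransversal.

Section Bigyrodecomposition.
Variables (G : groupType) (HL : subgroup G) (B : set G) (HR : subgroup G).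
Hypothesis BD : bigyrodecomposition HL B HR.

Lemma trans_lgyr_op (a b : B) (x := lgyr BD a b a) (y := bitrans_op BD a b) :
  transL BD x y = transL BD a b /\ transR BD x y = transR BD a b.
Proof.
have [_ _ Baba] := bgd_twisted BD.
have [lE rE] := trans_op_lgyr BD (Baba _ _ (valP a) (valP b)).
split; apply: val_inj.
  by rewrite -(bgd_transLV BD y x) lE invgK.
by rewrite -(bgd_transRV BD y x) rE invgK.
Qed.

End Bigyrodecomposition.

Theorem theorem4p2 (G : groupType) (B : set G) (HL HR : subgroup G)
    (BD : bigyrodecomposition HL B HR) :
  bigyrogroupoid (bitrans_op BD) (lgyr BD) (rgyr BD).
Proof.
have [B1 BV _] := bgd_twisted BD.
pose zero : B := exist (fun x => x \in B) 1 B1.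
exists zero; split.
- by move=> a; split; apply: val_inj;
    rewrite (bitrans_op_in BD) /= ?mul1g ?mulg1 ?(valP a).
- move=> a; exists (exist (fun x => x \in B) _ (BV _ (valP a))); apply: val_inj.
  by rewrite (bitrans_op_in BD) /= mulVg.
- exact: lgyr_automorphism.
- exact: rgyr_automorphism.
- exact: bitrans_op_gyro_assoc.
- move=> a b c; apply: val_inj => /=.
  by have [-> _] := trans_lgyr_op BD a b.
- move=> a b c; apply: val_inj => /=.
  by have [_ ->] := trans_lgyr_op BD a b.
- move=> a c; apply: val_inj => /=.
  have Ba1 : val a * val zero \in B by rewrite mulg1 (valP a).
  have [_ _ ->] := bifactors_in BD Ba1.
  by rewrite invg1 mul1g mulg1.
- move=> a c; apply: val_inj => /=.
  have Ba1 : val a * val zero \in B by rewrite mulg1 (valP a).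
  have [-> _ _] := bifactors_in BD Ba1.
  by rewrite invg1 mul1g mulg1.
Qed.
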